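(* Let $G=(V,E)$ be an acyclic transitive directed graph and $\overline{G}$ its complement. Then (i) for every orientation $H$ of $\overline{G}$, the graph $G\setminus\mathcal{U}(H^* )$ (on $V$, with edge set $E\setminus(E_H^*\cup(E_H^* )^{-1})$ where $E_H^*$ is the edge set of the transitive closure $H^*$ of $H$) is a 2-dimensional subgraph of $G$; and (ii) every locally maximal 2-dimensional subgraph $S$ of $G$ is of the form $S=G\setminus\mathcal{U}(H^* )$ for some orientation $H$ of $\overline{G}$.
   Context: All graphs are simple and directed; an undirected edge is represented as a pair of opposite directed edges. For $G=(V,E)$, $E^{-1}=\{(b,a)\mid (a,b)\in E\}$, $\mathcal{U}(G)=(V,E\cup E^{-1})$, and the complement of $G$ is $(V,\{(a,b)\mid a,b\in V,\ a\neq b\}\setminus (E\cup E^{-1}))$. A graph is transitive if $(a,b),(b,c)\in E$ with $a\neq c$ implies $(a,c)\in E$; the transitive closure has as edge set the minimal transitive superset of the edge set. A graph $(V,E)$ is oriented if $E\cap E^{-1}=\emptyset$; $(V,E')$ is an orientation of $(V,E)$ if $E'$ is a maximal oriented subset of $E$. Subgraphs of $G$ are graphs $(V,E')$ with $E'\subseteq E$. An acyclic transitive graph is viewed as a strict partial order; it is 2-dimensional if its edge relation is the intersection of at most two linear orders on $V$. A 2-dimensional subgraph $S$ of $G$ is locally maximal if no 2-dimensional subgraph of $G$ has edge set strictly containing that of $S$. *)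

(* Defs.v *)
(* MathComp world, with classical sets from MathComp-Analysis. *)
From mathcomp Require Import all_boot.
From mathcomp Require Import boolp classical_sets.

Set Implicit Arguments.
Unset Strict Implicit.
Unset Printing Implicit Defensive.

Local Open Scope classical_set_scope.
Local Open Scope relation_scope.

(* Simple directed graphs on an arbitrary (possibly infinite) vertex type.
   An undirected edge is a pair of opposite directed edges. *)
Record digraph (V : Type) := Digraph {
  edges : set (V * V);
  loopless : forall a, ~ edges (a, a)
}.

Lemma digraph_eq (V : Type) (G H : digraph V) : edges G = edges H -> G = H.
Proof.
case: G H => [E hE] [F hF] /= EF; case: F / EF hF => hF.
by rewrite (Prop_irrelevance hE hF).
Qed.

Definition subgraph (V : Type) (H G : digraph V) : Prop :=
  edges H `<=` edges G.

Lemma symmetrize_loopless (V : Type) (G : digraph V) (a : V) :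
  ~ (edges G `|` (edges G)^-1) (a, a).
Proof. by case=> /= h; exact: loopless h. Qed.

(* The graph U(G). *)
Definition symmetrize (V : Type) (G : digraph V) : digraph V :=
  Digraph (symmetrize_loopless (G := G)).

Lemma compl_graph_loopless (V : Type) (G : digraph V) (a : V) :
  ~ ([set ab | ab.1 <> ab.2] `\` (edges G `|` (edges G)^-1)) (a, a).
Proof. by case=> /=. Qed.

Definition compl_graph (V : Type) (G : digraph V) : digraph V :=
  Digraph (compl_graph_loopless (G := G)).

Lemma diff_graph_loopless (V : Type) (G K : digraph V) (a : V) :
  ~ (edges G `\` edges K) (a, a).
Proof. by case=> h _; exact: loopless h. Qed.

Definition diff_graph (V : Type) (G K : digraph V) : digraph V :=
  Digraph (diff_graph_loopless (G := G) (K := K)).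

(* The side condition [a <> c] allows a transitive graph to contain
   directed cycles without containing loops. *)
Definition transitive_edges (V : Type) (E : set (V * V)) : Prop :=
  forall a b c : V, E (a, b) -> E (b, c) -> a <> c -> E (a, c).

Definition transitive_graph (V : Type) (G : digraph V) : Prop :=
  transitive_edges (edges G).

Lemma transitive_smallest (V : Type) (E : set (V * V)) :
  transitive_edges (smallest (@transitive_edges V) E).
Proof.
move=> a b c ab bc ac T [trT ET].
by apply: (trT a b c) => //; [apply: ab|apply: bc].
Qed.

Lemma tclosure_loopless (V : Type) (H : digraph V) (a : V) :
  ~ smallest (@transitive_edges V) (edges H) (a, a).
Proof.
move=> /(_ [set ab | ab.1 <> ab.2]) /=; apply => //; split=> //= -[x y] /= xy.
by move=> xy_eq; move: xy; rewrite xy_eq; exact: loopless.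
Qed.

(* The transitive closure of H, written H^* on paper. *)
Definition tclosure (V : Type) (H : digraph V) : digraph V :=
  Digraph (tclosure_loopless (H := H)).

(* It is the unique inclusion-minimal transitive superset. *)
Lemma tclosure_minimal (V : Type) (H : digraph V) (T : set (V * V)) :
  T = edges (tclosure H) <->
  [/\ transitive_edges T, edges H `<=` T &
      forall T', transitive_edges T' -> edges H `<=` T' -> T' `<=` T ->
        T' = T].
Proof.
split=> [->|[trT HT minT]].
  split; [exact: transitive_smallest|exact: sub_gen_smallest|].
  move=> T' trT' HT' T'H; apply/seteqP; split => //.
  exact: smallest_sub.
apply/esym/minT; [exact: transitive_smallest|exact: sub_gen_smallest|].
exact: smallest_sub.
Qed.

(* [cycle e c] holds when c is a closed e-walk; it is trivially true of the
   empty sequence. A pair of opposite edges is a cycle of length 2. *)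
Definition acyclic (V : Type) (G : digraph V) : Prop :=
  forall c : seq V, c <> [::] -> ~ cycle (fun a b => `[< edges G (a, b) >]) c.

Definition oriented (V : Type) (G : digraph V) : Prop :=
  edges G `&` (edges G)^-1 = set0.

Definition orientation (V : Type) (H G : digraph V) : Prop :=
  [/\ subgraph H G, oriented H &
      forall H' : digraph V, subgraph H' G -> oriented H' ->
        ~ (edges H `<` edges H')].

Definition strict_linear_order (V : Type) (L : set (V * V)) : Prop :=
  [/\ forall a, ~ L (a, a),
      forall a b c, L (a, b) -> L (b, c) -> L (a, c) &
      forall a b, a <> b -> L (a, b) \/ L (b, a)].

(* L1 and L2 may coincide, whence "at most two" linear orders. *)
Definition two_dimensional (V : Type) (S : digraph V) : Prop :=
  [/\ acyclic S, transitive_graph S &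
      exists L1 L2 : set (V * V),
        [/\ strict_linear_order L1, strict_linear_order L2 &
            edges S = L1 `&` L2]].

Definition two_dimensional_subgraph (V : Type) (S G : digraph V) : Prop :=
  subgraph S G /\ two_dimensional S.

Definition locally_maximal (V : Type) (S G : digraph V) : Prop :=
  two_dimensional_subgraph S G /\
  forall S' : digraph V, two_dimensional_subgraph S' G ->
    ~ (edges S `<` edges S').

(* Main.v *)
From mathcomp Require Import all_boot.
From mathcomp Require Import boolp classical_sets wochoice.
Require Import Defs.

Set Implicit Arguments.
Unset Strict Implicit.
Unset Printing Implicit Defensive.

Local Open Scope classical_set_scope.
Local Open Scope relation_scope.

(** Write [T] for the edges of the transitive closure of [H] and [S] for the
    edges of [G] outside [T] and its inverse. If [S] relates [a] to [b] and [b]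
    to [c], a path of [H] between [a] and [c] consists of vertices that [T] does
    not link to [b], hence comparable to [b] in [G], so one of its edges would
    jump over [b] and lie in [G]: this gives transitivity of [S].
    Breaking ties inside the strong components of [T] with a well-order yields a
    strict order [Q] that orients exactly the pairs not related by [S], and
    [S] is the intersection of the linear orders [S U Q] and [S U Q^-1].
    Conversely, if [S] is the intersection of [L1] and [L2], orient the
    complement of [G] along [L1 \ L2]: this set is transitive, so it contains the
    closure, and (i) together with local maximality gives (ii). *)

Definition strict_order (V : Type) (E : set (V * V)) : Prop :=
  (forall a, ~ E (a, a)) /\ (forall a b c, E (a, b) -> E (b, c) -> E (a, c)).

Lemma strict_order_asym (V : Type) (E : set (V * V)) (a b : V) :
  strict_order E -> E (a, b) -> ~ E (b, a).
Proof. by case=> irr tr ab /(tr _ _ _ ab) /irr. Qed.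

Lemma strict_order_inv (V : Type) (E : set (V * V)) :
  strict_order E -> strict_order E^-1.
Proof. by case=> irr tr; split=> [a /irr|a b c /= ab bc] //; exact: tr ab. Qed.

Lemma acyclic_transitive_strict_order (V : Type) (G : digraph V) :
  acyclic G -> transitive_graph G -> strict_order (edges G).
Proof.
move=> acG trG; split=> [|a b c ab bc]; first exact: loopless.
(* If [a = c], the two edges form a cycle of length 2. *)
apply: (trG a b c) => // ac; rewrite -{c}ac in bc.
apply: (acG [:: a; b]) => //=.
by apply/and3P; split=> //; apply/asboolP.
Qed.

Lemma acyclic_subgraph (V : Type) (H G : digraph V) :
  subgraph H G -> acyclic G -> acyclic H.
Proof.
move=> HG acG c c0 cyc; apply: (acG c c0); apply: sub_cycle cyc => a b.
by move=> /asboolP ab; apply/asboolP; exact: HG.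
Qed.

(** By maximality: otherwise [H] could be enlarged by [(a, b)] and stay oriented. *)
Lemma orientation_compl_total (V : Type) (G H : digraph V) (a b : V) :
  orientation H (compl_graph G) -> a <> b ->
  (edges G `|` (edges G)^-1) (a, b) \/ (edges H `|` (edges H)^-1) (a, b).
Proof.
case=> HG orH maxH ab; apply: contrapT => /not_orP[nG nH].
have ll c : ~ (edges H `|` [set (a, b)]) (c, c).
  by case=> [cc|[ca cb]]; [exact: loopless cc|apply: ab; rewrite -ca -cb].
apply: (maxH (Digraph ll)).
- by move=> x [/HG //|/= ->]; split.
- rewrite /oriented -subset0 => -[x y] /= [[xy|[xa yb]] [yx|[ya xb]]].
  + by have : (edges H `&` (edges H)^-1) (x, y) by []; rewrite orH.
  + by apply: nH; right; rewrite /= -ya -xb.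
  + by apply: nH; right; rewrite /= -xa -yb.
  + by apply: ab; rewrite -xa xb.
- split; first by move=> x; left.
  by move=> /(_ (a, b) (or_intror erefl)) abH; apply: nH; left.
Qed.

(** Stated for an abstract order [E] so that it applies both to [edges G] and to its inverse. *)
Lemma no_crossing_path (V : Type) (E : set (V * V)) (H : digraph V)
    (T := edges (tclosure H)) (S := E `\` (T `|` T^-1)) :
  strict_order E -> (forall a b, edges H (a, b) -> ~ E (a, b)) ->
  (forall a b, a <> b ->
    (E `|` E^-1) (a, b) \/ (edges H `|` (edges H)^-1) (a, b)) ->
  forall a b c, S (a, b) -> S (b, c) -> ~ T (a, c).
Proof.
move=> E_strict E_H EH_total a b c ab bc.
have HT : edges H `<=` T by exact: sub_gen_smallest.
have trT : transitive_edges T by exact: transitive_smallest.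
(* [A] contains [a] but not [c], and no edge of [H] leaves it. The relation [A x -> A y] is
   transitive, so checking the edges of [H] suffices for [T]. *)
pose A x := [\/ S (x, b), x = b | T (b, x)].
suff TA : T `<=` [set xy | A xy.1 -> A xy.2].
  move=> /TA /= /(_ (@Or31 _ _ _ ab))[[cb _]|cb|Tbc].
  - exact: strict_order_asym E_strict bc.1 cb.
  - by move: bc.1; rewrite cb; exact: E_strict.1.
  - by apply: bc.2; left.
apply: smallest_sub => [x y z /= xy yz _ /xy /yz //|[x y] /= xy].
have [->|yb] := pselect (y = b); first by move=> _; apply: Or32.
case=> [[xb nxb]|xb|bx]; last first.
- by apply: Or33; apply: (trT _ x); [|exact: HT|exact/nesym].
- by apply: Or33; rewrite -xb; exact: HT.
- have nyb : ~ T (y, b).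
    move=> Tyb; apply: nxb; left; apply: (trT _ y) => //; first exact: HT.
    by move=> e; move: xb; rewrite e; exact: E_strict.1.
  (* Without a [T]-link, [y] and [b] are comparable in [E]; if [b] came first, [E] would contain the
     edge [(x, y)] of [H]. *)
  have [Tby|nby] := pselect (T (b, y)); first exact: Or33.
  case: (EH_total _ _ yb) => [[Eyb|/= Eby]|[/HT //|/HT //]].
  + by apply: Or31; split=> // -[].
  + by case: (E_H _ _ xy); exact: E_strict.2 Eby.
Qed.

Lemma diff_tclosure_strict_order (V : Type) (G H : digraph V) :
  strict_order (edges G) -> orientation H (compl_graph G) ->
  strict_order (edges (diff_graph G (symmetrize (tclosure H)))).
Proof.
move=> oG orH; have [HG _ _] := orH.
split=> [a|a b c ab bc]; first exact: loopless.
split; first exact: oG.2 ab.1 bc.1.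
case=> /= Tac.
  apply: (no_crossing_path oG _ _ ab bc Tac) => x y.
  - by move=> /HG[_ nG] xy; apply: nG; left.
  - exact: orientation_compl_total.
(* A link from [c] back to [a] is excluded by reversing the order: the path then runs from [c]
   through [b] to [a]. *)
have swap x y : edges (diff_graph G (symmetrize (tclosure H))) (x, y) ->
    ((edges G)^-1 `\` (edges (tclosure H) `|` (edges (tclosure H))^-1)) (y, x).
  by case=> xy nT; split=> // -[yx|xy']; apply: nT; [right|left].
have oGV := strict_order_inv oG.
apply: (no_crossing_path oGV _ _ (swap _ _ bc) (swap _ _ ab) Tac) => x y.
- by move=> /HG[_ nG] xy; apply: nG; right.
- move=> /(orientation_compl_total orH)[[xy|xy]|]; last by right.
  + by left; right.
  + by left; left.
Qed.

Lemma strict_linear_order_exists (V : Type) :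
  exists L : set (V * V), strict_linear_order L.
Proof.
elim/Peq : V => V.
have [R woR] := well_ordering_principle V.
have wcR : wo_chain R predT by move=> A _; exact: woR.
have totR x y : R x y || R y x by exact: (wo_chainW wcR).
have antiR x y : R x y -> R y x -> x = y.
  by move=> xy yx; apply: (wo_chain_antisymmetric wcR) => //; rewrite xy.
have trR x y z : R x y -> R y z -> R x z.
  move=> xy yz.
  (* Transitivity is read off from the least element of [{x, y, z}]. *)
  have [|m [[]]] := woR [predU1 x & [predU1 y & pred1 z]].
    by exists x; rewrite !inE eqxx.
  rewrite !inE => /or3P[] /eqP -> lb _.
  - by apply: lb; rewrite !inE eqxx !orbT.
  - have /(antiR _ _ xy) -> // : R y x by apply: lb; rewrite !inE eqxx.
  - have zy : R z y by apply: lb; rewrite !inE eqxx orbT.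
    by rewrite -(antiR _ _ yz zy).
exists [set xy | R xy.1 xy.2 /\ xy.1 <> xy.2]; split=> /=.
- by move=> a [].
- move=> a b c [ab nab] [bc nbc]; split; first exact: trR bc.
  by move=> ac; apply: nab; apply: antiR => //; rewrite ac.
- move=> a b ab; have /orP[] := totR a b; first by left.
  by right; split=> //; exact/nesym.
Qed.

(** In a mixed chain from [a] through [b] to [c], having [a = c] or an edge from [c] to [a] would
    make some pair related by both [S] and [Q]. *)
Lemma strict_linear_order_union (V : Type) (S Q : set (V * V)) :
  strict_order S -> strict_order Q ->
  (forall a b, S (a, b) -> ~ (Q `|` Q^-1) (a, b)) ->
  (forall a b, a <> b -> (S `|` S^-1) (a, b) \/ (Q `|` Q^-1) (a, b)) ->
  strict_linear_order (S `|` Q).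
Proof.
move=> oS oQ SQ tot.
have totU a b : a <> b -> (S `|` Q) (a, b) \/ (S `|` Q) (b, a).
  by move=> /tot[[|]|[|]] h; [left; left|right; left|left; right|right; right].
split=> //; first by move=> a [/oS.1|/oQ.1].
have noSQ x y : S (x, y) -> ~ Q (x, y) by move=> /SQ nQ xy; apply: nQ; left.
have noSQV x y : S (x, y) -> ~ Q (y, x) by move=> /SQ nQ xy; apply: nQ; right.
move=> a b c [ab|ab] [bc|bc].
- by left; exact: oS.2 bc.
- have [ac|/totU[//|[ca|ca]]] := pselect (a = c).
  + by case: (noSQV _ _ ab); rewrite ac.
  + by case: (noSQV _ _ (oS.2 _ _ _ ca ab)).
  + by case: (noSQV _ _ ab); exact: oQ.2 ca.
- have [ac|/totU[//|[ca|ca]]] := pselect (a = c).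
  + by case: (noSQV _ _ bc); rewrite -ac.
  + by case: (noSQV _ _ (oS.2 _ _ _ bc ca)).
  + by case: (noSQV _ _ bc); exact: oQ.2 ab.
- by right; exact: oQ.2 bc.
Qed.

(** One-way edges of [T] are kept; two-way edges are directed along a linear order [W]. *)
Lemma tie_breaking (V : Type) (T : set (V * V)) :
  transitive_edges T -> (forall a, ~ T (a, a)) ->
  exists Q, [/\ strict_order Q, Q `<=` T & T `<=` Q `|` Q^-1].
Proof.
move=> trT irrT; have [W [irrW trW totW]] := strict_linear_order_exists V.
have neT x y : T (x, y) -> x <> y by move=> + e; rewrite e; exact: irrT.
exists [set ab | T ab /\ (T (ab.2, ab.1) -> W ab)]; split.
- split=> [a [/irrT //]|a b c /= [ab Wab] [bc Wbc]].
  have ac : a <> c.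
    move=> e; rewrite -{c}e in bc Wbc.
    by case: (irrW a); exact: trW (Wab bc) (Wbc ab).
  split=> [|ca]; first exact: trT bc ac.
  (* [T (c, a)] closes a cycle, so both steps are two-way and follow [W]. *)
  apply: (trW _ b); [apply: Wab|apply: Wbc].
  + by apply: (trT _ c) => //; exact/nesym/neT.
  + by apply: (trT _ a) => //; exact/nesym/neT.
- by move=> ab [].
- move=> [a b] ab; have [ba|nba] := pselect (T (b, a)); last by left.
  by have [Wab|Wba] := totW _ _ (neT _ _ ab); [left|right].
Qed.

Lemma diff_tclosure_two_dimensional (V : Type) (G H : digraph V) :
  acyclic G -> transitive_graph G -> orientation H (compl_graph G) ->
  two_dimensional_subgraph (diff_graph G (symmetrize (tclosure H))) G.
Proof.
move=> acG trG orH; have oG := acyclic_transitive_strict_order acG trG.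
have oS := diff_tclosure_strict_order oG orH.
have SG : subgraph (diff_graph G (symmetrize (tclosure H))) G by move=> ab [].
set S := diff_graph _ _ in oS SG *.
split=> //; split; first exact: acyclic_subgraph SG acG.
  by move=> a b c ab bc _; exact: oS.2 bc.
have [Q [oQ QT TQ]] := tie_breaking (@transitive_smallest V (edges H))
  (tclosure_loopless (H := H)).
have SQ a b : edges S (a, b) -> ~ (Q `|` Q^-1) (a, b).
  by case=> _ nT [/QT|/QT] Tab; apply: nT; [left|right].
have totSQ a b : a <> b ->
    (edges S `|` (edges S)^-1) (a, b) \/ (Q `|` Q^-1) (a, b).
  move=> ab; have [?|nQ] := pselect ((Q `|` Q^-1) (a, b)); [by right|left].
  have nT : ~ edges (tclosure H) (a, b) by move=> /TQ.
  have nTV : ~ edges (tclosure H) (b, a).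
    by move=> /TQ [|] h; apply: nQ; [right|left].
  case: (orientation_compl_total orH ab) => [[Gab|Gba]|[h|h]].
  - by left; split=> // -[].
  - by right; split=> // -[].
  - by case: nT; exact: sub_gen_smallest.
  - by case: nTV; exact: sub_gen_smallest.
exists (edges S `|` Q), (edges S `|` Q^-1); split.
- exact: strict_linear_order_union.
- apply: strict_linear_order_union => //; first exact: strict_order_inv.
  + by move=> a b /SQ nQ [h|h]; apply: nQ; [right|left].
  + move=> a b /totSQ[|[|] h]; [by left|by right; right|by right; left].
- rewrite -setUIr (_ : Q `&` Q^-1 = set0) ?setU0// -subset0 => -[a b] [ab ba].
  exact: strict_order_asym oQ ab ba.
Qed.

Lemma locally_maximal_diff_tclosure (V : Type) (G S : digraph V) :
  acyclic G -> transitive_graph G -> locally_maximal S G ->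
  exists H : digraph V, orientation H (compl_graph G) /\
    S = diff_graph G (symmetrize (tclosure H)).
Proof.
move=> acG trG [[SG [_ _ [L1 [L2 [linL1 linL2 SL]]]]] maxS].
have [irr1 tr1 tot1] := linL1; have [irr2 tr2 tot2] := linL2.
(* Off the diagonal this is [L1] minus [L2]; written as an intersection of two orders, it is visibly
   transitive. *)
pose Q := L1 `&` L2^-1.
have asym1 a b : L1 (a, b) -> ~ L1 (b, a) by move=> ab /(tr1 _ _ _ ab) /irr1.
have asym2 a b : L2 (a, b) -> ~ L2 (b, a) by move=> ab /(tr2 _ _ _ ab) /irr2.
have llH a : ~ (Q `&` edges (compl_graph G)) (a, a).
  by case=> _ aa; exact: loopless aa.
pose H := Digraph llH.
have orH : orientation H (compl_graph G).
  split; first by move=> ab [].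
    rewrite /oriented -subset0 => -[a b] [[[ab _] _] [[ba _] _]].
    exact: asym1 ab ba.
  (* An edge of [H'] joins vertices unrelated in [S], so [L1] and [L2] disagree on it. If [L1]
     reverses it, the opposite edge is in [H], and [H'] is not oriented. *)
  move=> H' H'G orH' [HH']; apply=> -[a b] ab; have [/= neab nab] := H'G _ ab.
  split; last exact: H'G ab.
  have nSab : ~ edges S (a, b) by move=> /SG ?; apply: nab; left.
  have nSba : ~ edges S (b, a) by move=> /SG ?; apply: nab; right.
  rewrite SL in nSab nSba.
  have [ab1|ba1] := tot1 _ _ neab; have [ab2|ba2] := tot2 _ _ neab.
  - by case: nSab.
  - by [].
  - have : (edges H' `&` (edges H')^-1) (a, b).
      split=> //; apply: HH'; split=> //.
      split=> [|[h|h]]; first exact/nesym.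
        by apply: nab; right.
      by apply: nab; left.
    by rewrite orH'.
  - by case: nSba.
exists H; split=> //; apply: digraph_eq.
have trQ : transitive_edges Q.
  by move=> a b c [ab ba] [bc cb] _; split; [exact: tr1 bc|exact: tr2 ba].
have TQ : edges (tclosure H) `<=` Q by apply: smallest_sub => // ab [].
have SS' : edges S `<=` edges (diff_graph G (symmetrize (tclosure H))).
  move=> [a b] ab; split; first exact: SG.
  move: ab; rewrite SL => -[ab1 ab2] [] /TQ[/=].
  - by move=> _; exact: asym2.
  - by move=> ba1 _; exact: asym1 ba1.
apply/seteqP; split=> //; apply: contrapT => S'S.
exact: maxS (diff_tclosure_two_dimensional acG trG orH) (conj SS' S'S).
Qed.

Theorem theorem12 (V : Type) (G : digraph V)
    (acG : acyclic G) (trG : transitive_graph G) :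
  (forall H : digraph V, orientation H (compl_graph G) ->
     two_dimensional_subgraph (diff_graph G (symmetrize (tclosure H))) G) /\
  (forall S : digraph V, locally_maximal S G ->
     exists H : digraph V, orientation H (compl_graph G) /\
       S = diff_graph G (symmetrize (tclosure H))).
Proof.
split=> [H|S]; first exact: diff_tclosure_two_dimensional.
exact: locally_maximal_diff_tclosure.
Qed.
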